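(* Fix $\rho\in(0,1)$. Then there exist constants $\gamma_1=\gamma_1(\rho)>0$ and $\gamma_2=\gamma_2(\rho)>0$, depending only on $\rho$, and for every integer $m\ge2$ constants $c_1=c_1(m,\rho)>0$ and $c_2=c_2(m,\rho)>0$, such that for all integers $k\ge2$ $$c_2k^{-\gamma_2}\le\lim_{n\to\infty}\mathcal{M}_\rho(k,n)\le c_1k^{-\gamma_1},$$ where $\mathcal{M}_\rho(k,n)$ (which depends on $m$) is the maximal agreement probability defined in the context.
   Context: Let $m\ge2$, $\Omega=\{1,\dots,m\}$, and let $x=(x_1,\dots,x_n)$ be a vector of $n$ i.i.d. random variables, each uniform on $\Omega$. For $\rho\in[0,1)$, $y$ is a $\rho$-correlated copy of $x$ if, for each $j\le n$ independently, $y_j=x_j$ with probability $\rho$ and $y_j=x'_j$ with probability $1-\rho$, where $x'$ is an independent copy of $x$. Let $y^1,\dots,y^k$ be $\rho$-correlated copies of $x$ that are conditionally independent given $x$. Player $i$ ($1\le i\le k$) uses a function $F_i:\Omega^n\to\Omega$ and outputs $F_i(y^i)$. A function $F:\Omega^n\to\Omega$ is balanced if $\mathbb{P}\{F(x)=j\}=1/m$ for all $j\in\Omega$. Define $$\mathcal{M}_\rho(k,n)=\sup_{(F_i)_{1\le i\le k}}\mathbb{P}\{F_1(y^1)=F_2(y^2)=\dots=F_k(y^k)\},$$ the supremum being over all choices of balanced functions $F_1,\dots,F_k$. For fixed $m,k,\rho$ this is non-decreasing in $n$, so the limit as $n\to\infty$ exists. *)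

(* Defs.v *)
From HB Require Import structures.
From mathcomp Require Import all_boot all_order all_algebra.
From mathcomp Require Import all_classical all_reals all_analysis.
Set Implicit Arguments.
Unset Strict Implicit.
Unset Printing Implicit Defensive.
Import Order.TTheory GRing.Theory Num.Theory.
Import numFieldNormedType.Exports.
Local Open Scope ring_scope.
Local Open Scope classical_set_scope.

(* The alphabet {1, ..., m} is represented by 'I_m = {0, ..., m - 1}. *)
Definition word (m n : nat) := {ffun 'I_n -> 'I_m}.

Definition Pr (R : realType) (T : finType) (p : T -> R) (E : pred T) : R :=
  \sum_(w | E w) p w.

(* The law of n i.i.d. uniform letters. *)
Definition unif_pmf (R : realType) (m n : nat) (x : word m n) : R :=
  \prod_(j < n) m%:R^-1.

Definition balanced (R : realType) (m n : nat) (F : word m n -> 'I_m) : Prop :=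
  forall a : 'I_m, Pr (@unif_pmf R m n) (fun x => F x == a) = m%:R^-1.

(* The randomness used to build one correlated copy of x: coordinate j carries
   a selection bit and the letter x'_j of the independent copy of x. *)
Definition noise (m n : nat) := {ffun 'I_n -> bool * 'I_m}.

Definition noise_pmf (R : realType) (rho : R) (m n : nat) (z : noise m n) : R :=
  \prod_(j < n) ((if (z j).1 then rho else 1 - rho) * m%:R^-1).

(* y_j = x_j if the bit is set (probability rho), y_j = x'_j otherwise. *)
Definition corr_copy (m n : nat) (x : word m n) (z : noise m n) : word m n :=
  [ffun j => if (z j).1 then x j else (z j).2].

(* The word x and the noises of the k players are independent, so that the
   copies y^1, ..., y^k are conditionally independent given x. *)
Definition outcome (m k n : nat) := (word m n * {ffun 'I_k -> noise m n})%type.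

Definition outcome_pmf (R : realType) (rho : R) (m k n : nat)
    (w : outcome m k n) : R :=
  unif_pmf R w.1 * \prod_(i < k) noise_pmf rho (w.2 i).

Definition copy (m k n : nat) (w : outcome m k n) (i : 'I_k) : word m n :=
  corr_copy w.1 (w.2 i).

Definition agreement (R : realType) (rho : R) (m k n : nat)
    (F : 'I_k -> word m n -> 'I_m) : R :=
  Pr (@outcome_pmf R rho m k n)
    (fun w => [forall i, forall i', F i (copy w i) == F i' (copy w i')]).

(* For n = 0 and m >= 2 there is no balanced function and the value is
   sup set0 = 0. *)
Definition max_agreement (R : realType) (rho : R) (m k n : nat) : R :=
  sup [set agreement rho F | F in
        [set F : 'I_k -> word m n -> 'I_m | forall i, balanced R (F i)]].

(* Main.v *)
Require Import Defs.
From mathcomp Require Import all_boot all_order all_algebra.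
From mathcomp Require Import all_classical all_reals all_analysis.
From mathcomp Require Import ring lra zify.
Import Order.TTheory GRing.Theory Num.Theory.
Import numFieldNormedType.Exports.
Local Open Scope ring_scope.
Local Open Scope classical_set_scope.
Set Implicit Arguments.
Unset Strict Implicit.
Unset Printing Implicit Defensive.

(** Both bounds are read off the noise operator [noise_op], the conditional
    expectation of a function of one correlated copy given [x]. Since the
    copies are independent given [x], the agreement probability is the mean
    over [x] of the sum over the letters [a] of the products, over the
    players, of the operator applied to the indicator of [F_i = a]
    ([agreementE]).

    Upper bound. By the inequality of means it suffices to bound the [k]-th
    moment [M] of [w = noise_op 1_E] for a set [E] of measure at most 1/2. The
    tool is reverse hypercontractivity: for a [rho]-correlated pair [(x, y)],
    a large natural exponent [s] and nonnegative [u], [v], [(E u)^s (E v)^s <=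
    E (u(x)^s v(y)^s)]. It is proved for one letter by convexity
    ([reverse_holder]) with an [s] that depends on [rho] only, whatever the
    alphabet, and it passes to words by induction on their length
    ([reverse_hypercontractive_tensor]). With [u = w^k] and [v] the indicator
    of the complement of [E], whose image under the operator is [1 - w], it
    gives [(M / 2)^s <= E (w^(k s) (1 - w))]. As [w^j (1 - w) <= 1 / (j + 1)]
    on [[0, 1]], the right-hand side is at most [M / k], so that [M] is
    [O(k^(- 1 / (s - 1)))] ([noise_op_moment]).

    Lower bound. Call half of the letters (rounded down) good. Let all the
    players answer the letter 0 on the words whose proportion of good letters
    exceeds the expected one by [rho / 4] or more, and complete this common
    answer to a balanced function. A word of good letters only has probability
    at least [3^-n]; given such an [x], the expected proportion of good
    letters in a copy exceeds the unconditional one by [rho / 2] or more,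
    hence by a Chernoff bound it misses the threshold with probability at most
    [r^n], with [r < 1] depending on [rho] only. The same bound shows that the
    threshold set has measure at most [r^n]. For [n] of order [ln (k m)] with
    [r^n <= 1 / (k m)], the set is small enough to be completed to a balanced
    function, and all the players answer 0 with probability at least [3^-n /
    2], a power of [k] ([exists_agreement_ge], [exists_power_window]).

    The limit exists because ignoring a letter embeds the strategies on words
    of length [n] into those on words of length [n + 1]. *)

(** * A reverse Hölder inequality for one letter *)

Lemma bernoulli_expr (R : realType) (x : R) (n : nat) :
  0 <= x -> 1 + n%:R * (x - 1) <= x ^+ n.
Proof.
move=> x0; elim: n => [|n IH]; first by rewrite mul0r addr0 expr0.
rewrite exprS; apply: le_trans (ler_wpM2l x0 IH).
rewrite -natr1 -subr_ge0.
have -> : x * (1 + n%:R * (x - 1)) - (1 + (n%:R + 1) * (x - 1)) =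
          n%:R * (x - 1) ^+ 2 by ring.
by rewrite mulr_ge0 ?ler0n ?sqr_ge0.
Qed.

(** What [x ^ (t + 1)] gains over its tangent at 1. Below 1 the gain is
    limited by the value at 0, to a constant linear in [t]; above 1 half of
    the second derivative at 1 gives a constant quadratic in [t]. Having the
    quadratic gain on one side is what makes every [rho < 1] reachable. *)
Definition convexity_gap (R : realType) (t : nat) (x : R) : R :=
  if x <= 1 then t%:R * (x - 1) ^+ 2
  else t.+1%:R * t%:R / 2 * (x - 1) ^+ 2.

Lemma convexity_gap_ge0 (R : realType) (t : nat) (x : R) :
  0 <= convexity_gap t x.
Proof.
by rewrite /convexity_gap; case: ifP => _; rewrite mulr_ge0 ?sqr_ge0.
Qed.

Lemma bernoulli_convexity_gap (R : realType) (t : nat) (x : R) :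
  0 <= x -> 1 + t.+1%:R * (x - 1) + convexity_gap t x <= x ^+ t.+1.
Proof.
move=> x0; rewrite /convexity_gap; case: ifP => x1.
  elim: t => [|t IH]; first by rewrite expr1; lra.
  rewrite exprS; apply: le_trans (ler_wpM2l x0 IH).
  rewrite -!natr1 -subr_ge0; set T := t%:R.
  suff -> : x * (1 + (T + 1) * (x - 1) + T * (x - 1) ^+ 2) -
    (1 + (T + 1 + 1) * (x - 1) + (T + 1) * (x - 1) ^+ 2) =
    T * x * (x - 1) ^+ 2 by rewrite mulr_ge0 ?sqr_ge0 // mulr_ge0.
  by ring.
have {}x1 : 1 <= x by rewrite leNgt; apply/negP => /ltW; rewrite x1.
elim: t => [|t IH]; first by rewrite expr1; lra.
rewrite exprS; apply: le_trans (ler_wpM2l x0 IH).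
rewrite -[t.+2%:R]natr1 -[t.+1%:R]natr1 -subr_ge0; set T := t%:R.
suff -> : x * (1 + (T + 1) * (x - 1) + (T + 1) * T / 2 * (x - 1) ^+ 2) -
    (1 + (T + 1 + 1) * (x - 1) + (T + 1 + 1) * (T + 1) / 2 * (x - 1) ^+ 2) =
    (T + 1) * T / 2 * (x - 1) ^+ 2 * (x - 1).
  rewrite mulr_ge0 ?subr_ge0 // mulr_ge0 ?sqr_ge0 // divr_ge0 //.
  by rewrite mulr_ge0 // addr_ge0.
by field.
Qed.

(** The discriminant condition for the quadratic form in
    [convexity_gap_young]. For [rho < 1] it holds for every large [t], as the
    left side is linear and the right side quadratic in [t]. *)
Definition admissible_exponent (R : realType) (rho : R) (t : nat) :=
  rho ^+ 2 * t.+1%:R <= 2 * (1 - rho) ^+ 2 * t%:R ^+ 2.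

(** The correlation term hurts only if [x] and [y] are on opposite sides of 1.
    One of the two gaps then has the constant [t] and the other one [t (t + 1)
    / 2], and the claim is that a binary quadratic form is positive. *)
Lemma convexity_gap_young (R : realType) (rho : R) (t : nat) (x y : R) :
  0 <= rho -> rho < 1 -> (0 < t)%N -> admissible_exponent rho t ->
  - (rho * t.+1%:R * ((x - 1) * (y - 1))) <=
  (1 - rho) * (convexity_gap t x + convexity_gap t y).
Proof.
move=> rho0 rho1 t0 adm.
wlog xy : x y / x <= y => [W|].
  have /orP[/W//|/W] := le_total x y.
  by rewrite [(y - 1) * _]mulrC [convexity_gap t y + _]addrC.
have gx := convexity_gap_ge0 t x; have gy := convexity_gap_ge0 t y.
have [oppo|same] := boolP ((x <= 1) && (1 < y)); last first.
  apply: (@le_trans _ _ 0); last by rewrite mulr_ge0 ?subr_ge0 ?addr_ge0 // ltW.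
  rewrite oppr_le0; apply: mulr_ge0; first by rewrite mulr_ge0.
  move: same; rewrite negb_and -ltNge -leNgt => /orP[h|h].
    by rewrite mulr_ge0 // subr_ge0 ltW // (lt_le_trans h).
  by rewrite mulr_le0 // subr_le0 // (le_trans xy).
move: oppo => /andP[x1 y1]; rewrite /convexity_gap x1 [y <= 1]leNgt y1 /=.
set q := 1 - rho; set S := t.+1%:R; set T := t%:R.
have q0 : 0 < q by rewrite /q; lra.
have T0 : 0 < T by rewrite ltr0n.
have S0 : 0 < S by rewrite ltr0n.
(* Multiplying by [4 q T] completes the square in [b]. *)
rewrite -subr_ge0 -(pmulr_rge0 _ (_ : 0 < 4 * (q * T))) ?mulr_gt0 //.
set a := y - 1; set b := x - 1.
suff -> : 4 * (q * T) *
   (q * (T * b ^+ 2 + S * T / 2 * a ^+ 2) - - (rho * S * (b * a))) =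
   (2 * q * T * b + rho * S * a) ^+ 2 +
   S * a ^+ 2 * (2 * q ^+ 2 * T ^+ 2 - rho ^+ 2 * S).
  by rewrite addr_ge0 ?sqr_ge0 // mulr_ge0 ?subr_ge0 // mulr_ge0 ?sqr_ge0 ?ltW.
by field.
Qed.

(** Bernoulli's inequality for [x y]; the cross term [(x - 1) (y - 1)] that it
    leaves is paid for by the gaps. *)
Lemma convexity_gap_pair (R : realType) (rho : R) (t : nat) (x y : R) :
  0 <= rho -> rho < 1 -> (0 < t)%N -> admissible_exponent rho t ->
  0 <= x -> 0 <= y ->
  rho * (1 + t.+1%:R * (x - 1) + t.+1%:R * (y - 1)) <=
  rho * (x ^+ t.+1 * y ^+ t.+1) +
  (1 - rho) * (convexity_gap t x + convexity_gap t y).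
Proof.
move=> rho0 rho1 t0 adm x0 y0.
have := convexity_gap_young x y rho0 rho1 t0 adm.
have := ler_wpM2l rho0 (bernoulli_expr t.+1 (mulr_ge0 x0 y0)).
rewrite -exprMn; set g := (1 - rho) * _; set p := rho * _ ^+ _.
set S := t.+1%:R => h1 h2; rewrite -subr_ge0.
have -> : p + g - rho * (1 + S * (x - 1) + S * (y - 1)) =
  (p - rho * (1 + S * (x * y - 1))) +
  (g - - (rho * S * ((x - 1) * (y - 1)))) by ring.
by rewrite addr_ge0 ?subr_ge0.
Qed.

(** For functions of mean 1 the linear terms integrate to 0. The product of
    the two moments is at least 1 plus the mean gaps, and these gaps offset
    the loss in the correlated term by [convexity_gap_pair]. *)
Lemma reverse_holder_mean1 (R : realType) (rho : R) (t : nat)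
    (I : finType) (mu u v : I -> R) :
  0 <= rho -> rho < 1 -> (0 < t)%N -> admissible_exponent rho t ->
  (forall i, 0 <= mu i) -> \sum_i mu i = 1 ->
  (forall i, 0 <= u i) -> (forall i, 0 <= v i) ->
  \sum_i mu i * u i = 1 -> \sum_i mu i * v i = 1 ->
  1 <= rho * (\sum_i mu i * (u i ^+ t.+1 * v i ^+ t.+1)) +
       (1 - rho) * ((\sum_i mu i * u i ^+ t.+1) * (\sum_i mu i * v i ^+ t.+1)).
Proof.
move=> rho0 rho1 t0 adm mu0 mu1 u0 v0 Eu Ev.
pose gap w := \sum_i mu i * convexity_gap t (w i : R).
have gap0 w : 0 <= gap w.
  by apply: sumr_ge0 => i _; rewrite mulr_ge0 ?convexity_gap_ge0.
have centered w : \sum_i mu i * w i = 1 -> \sum_i mu i * (w i - 1) = 0.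
  move=> Ew; rewrite (eq_bigr (fun i => mu i * w i - mu i)).
    by rewrite sumrB Ew mu1 subrr.
  by move=> i _; rewrite mulrBr mulr1.
have moment w : (forall i, 0 <= w i) -> \sum_i mu i * w i = 1 ->
    1 + gap w <= \sum_i mu i * w i ^+ t.+1.
  move=> w0 Ew.
  have -> : 1 + gap w = \sum_i mu i *
      (1 + t.+1%:R * (w i - 1) + convexity_gap t (w i)).
    rewrite (eq_bigr (fun i => mu i + t.+1%:R * (mu i * (w i - 1)) +
       mu i * convexity_gap t (w i))) => [|i _]; last by ring.
    by rewrite !big_split /= mu1 -mulr_sumr centered // mulr0 addr0.
  by apply: ler_sum => i _; rewrite ler_wpM2l // bernoulli_convexity_gap.
have mu_ := moment _ u0 Eu; have mv := moment _ v0 Ev.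
have prod_ge : 1 + gap u + gap v <=
    (\sum_i mu i * u i ^+ t.+1) * (\sum_i mu i * v i ^+ t.+1).
  apply: (@le_trans _ _ ((1 + gap u) * (1 + gap v))).
    by have := mulr_ge0 (gap0 u) (gap0 v); lra.
  by apply: ler_pM => //; rewrite addr_ge0.
have pair_ge : rho <= rho * (\sum_i mu i * (u i ^+ t.+1 * v i ^+ t.+1)) +
    (1 - rho) * (gap u + gap v).
  have -> : (1 - rho) * (gap u + gap v) = \sum_i mu i *
      ((1 - rho) * (convexity_gap t (u i) + convexity_gap t (v i))).
    rewrite /gap -big_split mulr_sumr /=.
    by apply: eq_bigr => i _; ring.
  rewrite mulr_sumr -big_split /=.
  have {1}-> : rho = \sum_i mu i *
      (rho * (1 + t.+1%:R * (u i - 1) + t.+1%:R * (v i - 1))).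
    rewrite (eq_bigr (fun i => rho * mu i +
       (rho * t.+1%:R) * (mu i * (u i - 1)) +
       (rho * t.+1%:R) * (mu i * (v i - 1)))) => [|i _]; last by ring.
    by rewrite !big_split /= -!mulr_sumr mu1 !centered // !mulr0 !addr0 mulr1.
  apply: ler_sum => i _.
  have := ler_wpM2l (mu0 i) (convexity_gap_pair rho0 rho1 t0 adm (u0 i) (v0 i)).
  move=> h; apply: le_trans h _.
  by rewrite le_eqVlt; apply/orP; left; apply/eqP; ring.
have : (1 - rho) * (1 + gap u + gap v) <= (1 - rho) *
    ((\sum_i mu i * u i ^+ t.+1) * (\sum_i mu i * v i ^+ t.+1)).
  by rewrite ler_wpM2l // subr_ge0 ltW.
lra.
Qed.

(** Homogeneity reduces this to means equal to 1; if a mean vanishes, so does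
    the left side. *)
Lemma reverse_holder (R : realType) (rho : R) (t : nat)
    (I : finType) (mu u v : I -> R) :
  0 <= rho -> rho < 1 -> (0 < t)%N -> admissible_exponent rho t ->
  (forall i, 0 <= mu i) -> \sum_i mu i = 1 ->
  (forall i, 0 <= u i) -> (forall i, 0 <= v i) ->
  (\sum_i mu i * u i) ^+ t.+1 * (\sum_i mu i * v i) ^+ t.+1 <=
  rho * (\sum_i mu i * (u i ^+ t.+1 * v i ^+ t.+1)) +
  (1 - rho) * ((\sum_i mu i * u i ^+ t.+1) * (\sum_i mu i * v i ^+ t.+1)).
Proof.
move=> rho0 rho1 t0 adm mu0 mu1 u0 v0.
set Eu := \sum_i mu i * u i; set Ev := \sum_i mu i * v i.
have rhs0 : 0 <= rho * (\sum_i mu i * (u i ^+ t.+1 * v i ^+ t.+1)) +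
  (1 - rho) * ((\sum_i mu i * u i ^+ t.+1) * (\sum_i mu i * v i ^+ t.+1)).
  have S0 w : (forall i, 0 <= w i) -> 0 <= \sum_i mu i * w i.
    by move=> w0; apply: sumr_ge0 => i _; rewrite mulr_ge0.
  rewrite addr_ge0 // mulr_ge0 ?mulr_ge0 ?S0 //; [|lra|..] => i;
  by rewrite ?mulr_ge0 ?exprn_ge0.
have [Eu0|Eu0] := eqVneq Eu 0; first by rewrite Eu0 expr0n mul0r.
have [Ev0|Ev0] := eqVneq Ev 0; first by rewrite Ev0 expr0n mulr0.
have Eu_gt0 : 0 < Eu.
  by rewrite lt_def Eu0 sumr_ge0 // => i _; rewrite mulr_ge0.
have Ev_gt0 : 0 < Ev.
  by rewrite lt_def Ev0 sumr_ge0 // => i _; rewrite mulr_ge0.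
have norm1 w : \sum_i mu i * w i != 0 ->
    \sum_i mu i * (w i / \sum_i mu i * w i) = 1.
  move=> w0; under eq_bigr do rewrite mulrA.
  by rewrite -mulr_suml divff.
have := @reverse_holder_mean1 _ _ _ _ mu (fun i => u i / Eu)
  (fun i => v i / Ev) rho0 rho1 t0 adm mu0 mu1.
move=> /(_ (fun i => divr_ge0 (u0 i) (ltW Eu_gt0)))
  /(_ (fun i => divr_ge0 (v0 i) (ltW Ev_gt0))) /(_ (norm1 _ Eu0) (norm1 _ Ev0)).
have pu : Eu ^+ t.+1 != 0 by rewrite expf_neq0.
have pv : Ev ^+ t.+1 != 0 by rewrite expf_neq0.
under eq_bigr => i _.
  rewrite !expr_div_n.
  rewrite (_ : _ * _ = mu i * (u i ^+ t.+1 * v i ^+ t.+1) /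
    (Eu ^+ t.+1 * Ev ^+ t.+1)); last by field; rewrite pu pv.
  over.
under [X in _ * (X * _)]eq_bigr do rewrite expr_div_n mulrA.
under [X in _ * (_ * X)]eq_bigr do rewrite expr_div_n mulrA.
rewrite -!mulr_suml => h.
have D0 : 0 < Eu ^+ t.+1 * Ev ^+ t.+1 by rewrite mulr_gt0 ?exprn_gt0.
have := ler_wpM2l (ltW D0) h; rewrite mulr1 => h2; apply: (le_trans h2).
by rewrite le_eqVlt; apply/orP; left; apply/eqP; field; rewrite pu pv.
Qed.

(** * Tensorization over the coordinates *)

Definition ffun_cons (T : finType) (n : nat) (p : T * {ffun 'I_n -> T}) :
  {ffun 'I_n.+1 -> T} := [ffun j => oapp p.2 p.1 (unlift ord0 j)].

Definition ffun_tail (T : finType) (n : nat) (x : {ffun 'I_n.+1 -> T}) :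
  {ffun 'I_n -> T} := [ffun j => x (lift ord0 j)].

Lemma ffun_cons0 (T : finType) (n : nat) (p : T * {ffun 'I_n -> T}) :
  ffun_cons p ord0 = p.1.
Proof. by rewrite ffunE unlift_none. Qed.

Lemma ffun_consS (T : finType) (n : nat) (p : T * {ffun 'I_n -> T}) j :
  ffun_cons p (lift ord0 j) = p.2 j.
Proof. by rewrite ffunE liftK. Qed.

Lemma ffun_consK (T : finType) (n : nat) (p : T * {ffun 'I_n -> T}) :
  ffun_tail (ffun_cons p) = p.2.
Proof. by apply/ffunP => j; rewrite ffunE ffun_consS. Qed.

Lemma sum_ffun0 (R : realType) (T : finType) (f : {ffun 'I_0 -> T} -> R) :
  \sum_x f x = f (ffun0 (card_ord 0)).
Proof.
rewrite (big_pred1 (ffun0 (card_ord 0))) // => x; apply/esym/eqP.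
by apply/ffunP => -[].
Qed.

(** Splitting off the first coordinate, the reindexing behind every induction
    on the length of words. *)
Lemma sum_ffunS (R : realType) (T : finType) (n : nat)
    (f : {ffun 'I_n.+1 -> T} -> R) :
  \sum_x f x = \sum_a \sum_y f (ffun_cons (a, y)).
Proof.
rewrite pair_bigA /= (reindex (@ffun_cons T n)) /=.
  by apply: eq_bigr => -[a y].
exists (fun x : {ffun _ -> T} => (x ord0, ffun_tail x)) => [[a y]|x] _.
  by rewrite ffun_cons0 ffun_consK.
apply/ffunP => j; have [i ->|->] := unliftP ord0 j.
  by rewrite ffun_consS ffunE.
by rewrite ffun_cons0.
Qed.

Lemma prod_ffun_cons (R : realType) (T U : finType) (n : nat) (g : T -> U -> R)
    (p : T * {ffun 'I_n -> T}) (q : U * {ffun 'I_n -> U}) :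
  \prod_j g (ffun_cons p j) (ffun_cons q j) =
  g p.1 q.1 * \prod_j g (p.2 j) (q.2 j).
Proof.
rewrite big_ord_recl !ffun_cons0; congr (_ * _).
by apply: eq_bigr => j _; rewrite !ffun_consS.
Qed.

(** [J] is the joint law of the pair and [mu] its marginals. With [f = u^s]
    and [g = v^s], where [s = t + 1], this is the reverse two-function
    inequality [E (f(x) g(y)) >= |f|_(1/s) |g|_(1/s)]; writing it for [u] and
    [v] avoids roots. *)
Definition reverse_hypercontractive (R : realType) (T : finType) (t : nat)
    (J : T -> T -> R) (mu : T -> R) : Prop :=
  forall u v : T -> R, (forall a, 0 <= u a) -> (forall b, 0 <= v b) ->
  (\sum_a mu a * u a) ^+ t.+1 * (\sum_b mu b * v b) ^+ t.+1 <=
  \sum_a \sum_b J a b * (u a ^+ t.+1 * v b ^+ t.+1).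

(** Conditionally on the first letters, the induction hypothesis bounds the
    inner mean below by the [s]-th powers of the partial means of [u] and [v];
    the one-letter inequality then applies to these partial means. *)
Lemma reverse_hypercontractive_tensor (R : realType) (T : finType) (t n : nat)
    (J : T -> T -> R) (mu : T -> R) :
  (forall a b, 0 <= J a b) -> (forall a, 0 <= mu a) ->
  reverse_hypercontractive t J mu ->
  reverse_hypercontractive t
    (fun x y : {ffun 'I_n -> T} => \prod_j J (x j) (y j))
    (fun x : {ffun 'I_n -> T} => \prod_j mu (x j)).
Proof.
move=> J0 mu0 Jrh; elim: n => [|n IH] u v u0 v0.
  rewrite !sum_ffun0.
  by rewrite !big_ord0 !mul1r.
have muP (x : {ffun 'I_n -> T}) : 0 <= \prod_(j < n) mu (x j) by apply: prodr_ge0.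
pose marg (w : {ffun 'I_n.+1 -> T} -> R) (a : T) :=
  \sum_(x : {ffun 'I_n -> T}) (\prod_j mu (x j)) * w (ffun_cons (a, x)).
have margE w : \sum_(x : {ffun 'I_n.+1 -> T}) (\prod_j mu (x j)) * w x =
    \sum_a mu a * marg w a.
  rewrite sum_ffunS; apply: eq_bigr => a _.
  rewrite mulr_sumr; apply: eq_bigr => x _.
  by rewrite (prod_ffun_cons (fun a _ => mu a) (a, x) (a, x)) mulrA.
have marg0 w : (forall x, 0 <= w x) -> forall a, 0 <= marg w a.
  by move=> w0 a; apply: sumr_ge0 => x _; rewrite mulr_ge0.
rewrite !margE; apply: le_trans (Jrh _ _ (marg0 _ u0) (marg0 _ v0)) _.
rewrite sum_ffunS; apply: ler_sum => a _.
rewrite [leRHS](eq_bigr (fun x : {ffun 'I_n -> T} => \sum_b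
    \sum_(y : {ffun 'I_n -> T}) J a b * (\prod_j J (x j) (y j) *
    (u (ffun_cons (a, x)) ^+ t.+1 * v (ffun_cons (b, y)) ^+ t.+1)))); last first.
  move=> x _; rewrite sum_ffunS; apply: eq_bigr => b _; apply: eq_bigr => y _.
  by rewrite (prod_ffun_cons J (a, x) (b, y)) -mulrA.
rewrite exchange_big /=; apply: ler_sum => b _.
rewrite [leRHS](eq_bigr (fun x : {ffun 'I_n -> T} => J a b *
    \sum_(y : {ffun 'I_n -> T}) (\prod_j J (x j) (y j) *
    (u (ffun_cons (a, x)) ^+ t.+1 * v (ffun_cons (b, y)) ^+ t.+1)))); last first.
  by move=> x _; rewrite mulr_sumr.
by rewrite -mulr_sumr ler_wpM2l // IH.
Qed.

(** * The noise operator and the agreement probability *)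

(** The probability that a letter [a] of [x] is copied as [b]. *)
Definition letter_kernel (R : realType) (rho : R) (m : nat) (a b : 'I_m) : R :=
  (if a == b then rho else 0) + (1 - rho) * m%:R^-1.

Definition word_kernel (R : realType) (rho : R) (m n : nat)
  (x y : word m n) : R := \prod_j letter_kernel rho (x j) (y j).

Definition noise_op (R : realType) (rho : R) (m n : nat)
  (f : word m n -> R) (x : word m n) : R := \sum_y word_kernel rho x y * f y.

Lemma letter_kernel_ge0 (R : realType) (rho : R) (m : nat) (a b : 'I_m) :
  0 <= rho -> rho < 1 -> 0 <= letter_kernel rho a b.
Proof.
move=> rho0 rho1; apply: addr_ge0; first by case: ifP.
by rewrite mulr_ge0 ?invr_ge0 // subr_ge0 ltW.
Qed.

Lemma sum_letter_kernel (R : realType) (rho : R) (m : nat) (a : 'I_m)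
    (f : 'I_m -> R) :
  \sum_b letter_kernel rho a b * f b =
  rho * f a + (1 - rho) * \sum_b m%:R^-1 * f b.
Proof.
under eq_bigr do rewrite mulrDl.
rewrite big_split /=; congr (_ + _).
  rewrite (bigD1 a) //= eqxx big1 ?addr0 // => b /negPf ba.
  by rewrite eq_sym ba mul0r.
by rewrite mulr_sumr; apply: eq_bigr => b _; rewrite mulrA.
Qed.

Lemma ord_natr_neq0 (R : realType) (m : nat) (a : 'I_m) : m%:R != 0 :> R.
Proof. by rewrite pnatr_eq0 -lt0n (leq_ltn_trans _ (ltn_ord a)). Qed.

Lemma letter_kernel_sum1 (R : realType) (rho : R) (m : nat) (a : 'I_m) :
  \sum_b letter_kernel rho a b = 1.
Proof.
under eq_bigr do rewrite -[letter_kernel _ _ _]mulr1.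
rewrite (sum_letter_kernel rho a (fun=> 1)) mulr1.
rewrite sumr_const card_ord mulr1 -[X in _ * X]mulr_natr mulVf ?mulr1.
  by rewrite addrC subrK.
exact: ord_natr_neq0 a.
Qed.

Lemma sum_prod_ffun (R : realType) (T : finType) (n : nat)
    (g : 'I_n -> T -> R) :
  \sum_(x : {ffun 'I_n -> T}) \prod_j g j (x j) = \prod_j \sum_a g j a.
Proof. by rewrite bigA_distr_bigA. Qed.

Lemma word_kernel_ge0 (R : realType) (rho : R) (m n : nat) (x y : word m n) :
  0 <= rho -> rho < 1 -> 0 <= word_kernel rho x y.
Proof. by move=> *; apply: prodr_ge0 => j _; apply: letter_kernel_ge0. Qed.

Lemma word_kernel_sum1 (R : realType) (rho : R) (m n : nat) (x : word m n) :
  \sum_y word_kernel rho x y = 1.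
Proof.
rewrite (sum_prod_ffun (fun j b => letter_kernel rho (x j) b)) big1 // => j _.
exact: letter_kernel_sum1.
Qed.

Lemma unif_pmf_ge0 (R : realType) (m n : nat) (x : word m n) :
  0 <= unif_pmf R x.
Proof. by apply: prodr_ge0 => j _; rewrite invr_ge0. Qed.

Lemma unif_pmf_sum1 (R : realType) (m n : nat) :
  (0 < m)%N -> \sum_(x : word m n) unif_pmf R x = 1.
Proof.
move=> m0; rewrite (sum_prod_ffun (fun _ _ => m%:R^-1)) big1 // => j _.
by rewrite sumr_const card_ord -[_^-1 *+ _]mulr_natr mulVf // pnatr_eq0 -lt0n.
Qed.

Lemma word_reverse_hypercontractive (R : realType) (rho : R) (t m n : nat) :
  0 <= rho -> rho < 1 -> (0 < t)%N -> admissible_exponent rho t -> (0 < m)%N ->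
  reverse_hypercontractive t
    (fun x y : word m n => unif_pmf R x * word_kernel rho x y)
    (@unif_pmf R m n).
Proof.
move=> rho0 rho1 t0 adm m0.
have -> : (fun x y : word m n => unif_pmf R x * word_kernel rho x y) =
    (fun x y => \prod_j (m%:R^-1 * letter_kernel rho (x j) (y j))).
  by apply/funext => x; apply/funext => y; rewrite big_split.
apply: (@reverse_hypercontractive_tensor _ _ t n
  (fun a b => m%:R^-1 * letter_kernel rho a b) (fun=> m%:R^-1)).
- by move=> a b; rewrite mulr_ge0 ?invr_ge0 // letter_kernel_ge0.
- by move=> a; rewrite invr_ge0.
move=> u v u0 v0.
apply: (le_trans (reverse_holder rho0 rho1 t0 adm _ _ u0 v0)).
- by move=> _; rewrite invr_ge0.
- by rewrite sumr_const card_ord -[_^-1 *+ _]mulr_natr mulVf // pnatr_eq0 -lt0n.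
rewrite le_eqVlt; apply/orP; left; apply/eqP.
rewrite mulr_suml !mulr_sumr -big_split /=; apply: eq_bigr => a _.
rewrite [RHS](eq_bigr (fun b => m%:R^-1 * u a ^+ t.+1 *
  (letter_kernel rho a b * v b ^+ t.+1))); last by move=> b _; ring.
rewrite -[RHS]mulr_sumr (sum_letter_kernel rho a (fun b => v b ^+ t.+1)).
by ring.
Qed.

(** The selection bits and the fresh letters are integrated out letter by
    letter: only the law of the copy given [x] remains. *)
Lemma sum_noise_corr_copy (R : realType) (rho : R) (m n : nat)
    (f : word m n -> R) (x : word m n) :
  \sum_z noise_pmf rho z * f (corr_copy x z) = noise_op rho f x.
Proof.
rewrite (partition_big (fun z => corr_copy x z) xpredT) //=.
apply: eq_bigr => y _.
rewrite (eq_bigr (fun z => noise_pmf rho z * f y)); last by move=> z /eqP ->.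
rewrite -mulr_suml; congr (_ * _).
rewrite big_mkcond /=.
pose g (j : 'I_n) (c : bool * 'I_m) :=
  (if c.1 then rho else 1 - rho) * m%:R^-1 *
  ((if c.1 then x j else c.2) == y j)%:R.
rewrite (eq_bigr (fun z : noise m n => \prod_j g j (z j))); last first.
  move=> z _; rewrite big_split /=; case: ifP => [/eqP <-|/negP xzy].
    by rewrite [X in _ * X]big1 ?mulr1 // => j _; rewrite ffunE eqxx.
  suff [j hj] : exists j, (if (z j).1 then x j else (z j).2) != y j.
    by rewrite [X in _ * X](bigD1 j) //= (negPf hj) mul0r mulr0.
  apply/existsP; apply: contraT => /existsPn h; case: xzy.
  by apply/eqP/ffunP => j; rewrite ffunE; apply/eqP; rewrite -[_ == _]negbK h.
rewrite sum_prod_ffun; apply: eq_bigr => j _.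
rewrite -(pair_bigA _ (fun b a => g j (b, a))) /= big_bool /= /g /=.
rewrite /letter_kernel; congr (_ + _).
  rewrite sumr_const card_ord -[_ * _ *+ _]mulr_natr; case: eqP => _ /=.
    by rewrite mulr1 divfK // (ord_natr_neq0 _ (x j)).
  by rewrite !mulr0 mul0r.
rewrite (bigD1 (y j)) //= eqxx mulr1 big1 ?addr0 // => a /negPf ->.
by rewrite mulr0.
Qed.

(** Agreement is the disjoint union over [a] of the events that all the
    players answer [a], and each such event is a product over the players
    given [x]. With no player, agreement would hold but belong to several of
    these events. *)
Lemma agreementE (R : realType) (rho : R) (m k n : nat)
    (F : 'I_k -> word m n -> 'I_m) : (0 < k)%N ->
  agreement rho F = \sum_x unif_pmf R x *
    \sum_a \prod_i noise_op rho (fun y => (F i y == a)%:R) x.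
Proof.
move=> k0; pose i0 := Ordinal k0.
pose ind (w : outcome m k n) : R := \sum_a \prod_i (F i (copy w i) == a)%:R.
have indE w : ind w =
    [forall i, forall i', F i (copy w i) == F i' (copy w i')]%:R.
  rewrite /ind; case: forallP => [all_eq|not_eq].
    have all0 i : F i (copy w i) = F i0 (copy w i0).
      by apply/eqP; have /forallP := all_eq i; apply.
    rewrite (bigD1 (F i0 (copy w i0))) //= [X in _ + X]big1 ?addr0.
      by rewrite big1 // => i _; rewrite all0 eqxx.
    by move=> a ha; rewrite (bigD1 i0) //= eq_sym (negPf ha) mul0r.
  rewrite big1 // => a _.
  suff [i hi] : exists i, F i (copy w i) != a.
    by rewrite (bigD1 i) //= (negPf hi) mul0r.
  apply/existsP; apply: contraT => /existsPn h; case: not_eq => i.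
  apply/forallP => i'.
  by have := h i; have := h i'; rewrite !negbK => /eqP -> /eqP ->.
rewrite /agreement /Pr big_mkcond /=.
rewrite (eq_bigr (fun w => outcome_pmf rho w * ind w)); last first.
  by move=> w _; rewrite indE; case: ifP; rewrite ?mulr1 ?mulr0.
rewrite -(pair_bigA _ (fun x zs => outcome_pmf rho (x, zs) * ind (x, zs))) /=.
apply: eq_bigr => x _; rewrite /outcome_pmf /=.
under eq_bigr do rewrite -mulrA.
rewrite -mulr_sumr; congr (_ * _).
rewrite /ind; under [LHS]eq_bigr do rewrite mulr_sumr.
rewrite exchange_big /=; apply: eq_bigr => a _.
under eq_bigr do rewrite -big_split /=.
rewrite (sum_prod_ffun (fun i z => noise_pmf rho z *
   (F i (corr_copy x z) == a)%:R)).
by apply: eq_bigr => i _; rewrite -sum_noise_corr_copy.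
Qed.

(** * Upper bound: moments of the noise operator *)

(** The terms [w ^ i (1 - w)], [i <= N], telescope to the right side and the
    last one is the smallest. *)
Lemma exprn_1subr_le (R : realType) (w : R) (N : nat) :
  0 <= w -> w <= 1 -> N.+1%:R * (w ^+ N * (1 - w)) <= 1 - w ^+ N.+1.
Proof.
move=> w0 w1; elim: N => [|N IH]; first by rewrite expr0 expr1 !mul1r.
have := ler_wpM2l w0 IH.
have : 0 <= (1 - w) * (1 - w ^+ N.+1).
  by rewrite mulr_ge0 // subr_ge0 // exprn_ile1.
rewrite -[N.+2%:R]natr1 !exprS; set p := w ^+ N; set S := N.+1%:R => h1 h2.
rewrite -subr_ge0.
have -> : 1 - w * (w * p) - (S + 1) * (w * p * (1 - w)) =
  (1 - w) * (1 - w * p) + (w * (1 - w * p) - w * (S * (p * (1 - w)))) by ring.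
by rewrite addr_ge0 // subr_ge0.
Qed.

Lemma prod_le_mean_exprn (R : realType) (k : nat) (w : 'I_k -> R) :
  (0 < k)%N -> (forall i, 0 <= w i) ->
  \prod_i w i <= k%:R^-1 * \sum_i w i ^+ k.
Proof.
move=> k0 w0.
have rhs0 : 0 <= k%:R^-1 * \sum_i w i ^+ k.
  by rewrite mulr_ge0 ?invr_ge0 ?sumr_ge0 // => i _; rewrite exprn_ge0.
rewrite -(ler_pXn2r k0) ?nnegrE ?prodr_ge0 //.
have := @leif_AGM R 'I_k 'I_k (fun i => w i ^+ k)
  (fun i _ => exprn_ge0 k (w0 i)).
by rewrite card_ord prodrXl mulrC => -[].
Qed.

Lemma noise_op_ge0 (R : realType) (rho : R) (m n : nat) (f : word m n -> R) x :
  0 <= rho -> rho < 1 -> (forall y, 0 <= f y) -> 0 <= noise_op rho f x.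
Proof.
move=> rho0 rho1 f0; apply: sumr_ge0 => y _.
by rewrite mulr_ge0 // word_kernel_ge0.
Qed.

Lemma noise_opC (R : realType) (rho : R) (m n : nat) (E : pred (word m n)) x :
  noise_op rho (fun y => (~~ E y)%:R) x =
  1 - noise_op rho (fun y => (E y)%:R) x :> R.
Proof.
rewrite -[X in X - _](word_kernel_sum1 rho x) /noise_op -sumrB.
apply: eq_bigr => y _; case: (E y);
by rewrite /= ?(mulr0n, mulr1n, mulr0, mulr1, subrr, subr0).
Qed.

(** Write [w] for the operator applied to [E] and [M] for the sum in the
    conclusion. Reverse hypercontractivity for [w ^ k] and the complement of
    [E] bounds [(M / 2) ^ (t + 1)] by the mean of [w ^ (k (t + 1)) (1 - w)]:
    if [w] were often close to 1, the complement of [E] would still be reached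
    too often. As [k <= k t + 1], the factor [w ^ (k t) (1 - w)] is at most [1
    / k], which leaves [M / k]. *)
Lemma noise_op_moment (R : realType) (rho : R) (t m n k : nat)
    (E : pred (word m n)) :
  0 <= rho -> rho < 1 -> (0 < t)%N -> admissible_exponent rho t ->
  (0 < m)%N -> (0 < k)%N ->
  \sum_x unif_pmf R x * (E x)%:R <= 2^-1 ->
  (\sum_x unif_pmf R x * noise_op rho (fun y => (E y)%:R) x ^+ k) ^+ t * k%:R
  <= 2 ^+ t.+1.
Proof.
move=> rho0 rho1 t0 adm m0 k0 Ehalf.
pose w : word m n -> R := noise_op rho (fun y => (E y)%:R).
have w0 x : 0 <= w x by apply: noise_op_ge0.
have w1 x : w x <= 1.
  by rewrite -subr_ge0 -noise_opC; apply: noise_op_ge0.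
rewrite -/w; set M := \sum_x _.
have M0 : 0 <= M.
  by apply: sumr_ge0 => x _; rewrite mulr_ge0 ?unif_pmf_ge0 ?exprn_ge0.
have Ehalf' : 2^-1 <= \sum_x unif_pmf R x * (~~ E x)%:R.
  have -> : \sum_x unif_pmf R x * (~~ E x)%:R =
      1 - \sum_x unif_pmf R x * (E x)%:R.
    rewrite -[X in X - _](unif_pmf_sum1 R n m0) -sumrB; apply: eq_bigr => x _.
    by case: (E x); rewrite /= ?(mulr0n, mulr1n, mulr0, mulr1, subrr, subr0).
  by lra.
have RH := @word_reverse_hypercontractive R rho t m n rho0 rho1 t0 adm m0
  (fun x => w x ^+ k) (fun y => (~~ E y)%:R) (fun x => exprn_ge0 k (w0 x))
  (fun y => ler0n _ _).
have upper : k%:R * \sum_x \sum_y unif_pmf R x * word_kernel rho x y *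
    ((w x ^+ k) ^+ t.+1 * (~~ E y)%:R ^+ t.+1) <= M.
  rewrite mulr_sumr; apply: ler_sum => x _.
  rewrite (eq_bigr (fun y => unif_pmf R x * (w x ^+ k) ^+ t.+1 *
      (word_kernel rho x y * (~~ E y)%:R))); last first.
    move=> y _; have -> : (~~ E y)%:R ^+ t.+1 = (~~ E y)%:R :> R.
      by case: (E y); rewrite /= ?expr1n ?expr0n.
    by ring.
  rewrite -mulr_sumr -/(noise_op _ _ x) noise_opC -/w.
  rewrite (_ : _ * _ = unif_pmf R x * (w x ^+ k *
      (k%:R * ((w x ^+ k) ^+ t * (1 - w x))))); last by rewrite exprS; ring.
  rewrite ler_wpM2l ?unif_pmf_ge0 // ler_piMr ?exprn_ge0 // -exprM.
  apply: (@le_trans _ _ ((k * t).+1%:R * (w x ^+ (k * t) * (1 - w x)))).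
    rewrite ler_wpM2r ?mulr_ge0 ?exprn_ge0 ?subr_ge0 // ler_nat.
    by rewrite (leq_trans (leq_pmulr k t0)).
  apply: (le_trans (exprn_1subr_le _ (w0 x) (w1 x))).
  by rewrite gerBl exprn_ge0.
have key : k%:R * (M ^+ t.+1 * 2^-1 ^+ t.+1) <= M.
  apply: le_trans upper; rewrite ler_wpM2l //; apply: le_trans RH.
  rewrite ler_wpM2l ?exprn_ge0 // lerXn2r // nnegrE ?invr_ge0 //.
  by apply: le_trans Ehalf'; rewrite invr_ge0.
have [->|Mn0] := eqVneq M 0.
  by rewrite expr0n eqn0Ngt t0 mul0r exprn_ge0.
have Mgt0 : 0 < M by rewrite lt_def Mn0.
(* One factor [M] of [key] cancels. *)
rewrite -(ler_pM2l Mgt0) -ler_pdivrMr ?exprn_gt0 //.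
by apply: le_trans key; rewrite exprVn [M ^+ t.+1]exprS le_eqVlt;
  apply/orP; left; apply/eqP; set c := _^-1; ring.
Qed.

Lemma noise_op_moment_powR (R : realType) (rho : R) (t m n k : nat)
    (E : pred (word m n)) :
  0 <= rho -> rho < 1 -> (0 < t)%N -> admissible_exponent rho t ->
  (0 < m)%N -> (0 < k)%N ->
  \sum_x unif_pmf R x * (E x)%:R <= 2^-1 ->
  \sum_x unif_pmf R x * noise_op rho (fun y => (E y)%:R) x ^+ k
  <= 4 * k%:R `^ (- t%:R^-1).
Proof.
move=> rho0 rho1 t0 adm m0 k0 Ehalf.
have kR : 0 < k%:R :> R by rewrite ltr0n.
rewrite -(ler_pXn2r t0) ?nnegrE ?mulr_ge0 ?powR_ge0 //; last first.
  apply: sumr_ge0 => x _; rewrite mulr_ge0 ?unif_pmf_ge0 ?exprn_ge0 //.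
  exact: noise_op_ge0.
rewrite exprMn -[_ `^ _ ^+ t]powR_mulrn ?powR_ge0 // -powRrM mulNr.
rewrite mulVf ?pnatr_eq0 -?lt0n //.
rewrite powR_inv1 ?ler0n // ler_pdivlMr //.
apply: le_trans (noise_op_moment rho0 rho1 t0 adm m0 k0 Ehalf) _.
have -> : (4 : R) = 2 ^+ 2 by rewrite expr2 -natrM.
rewrite -exprM ler_weXn2l ?ler1n //.
by lia.
Qed.

Lemma balancedE (R : realType) (m n : nat) (F : word m n -> 'I_m) :
  balanced R F <->
  (forall a, \sum_x unif_pmf R x * (F x == a)%:R = m%:R^-1).
Proof.
suff E a : Pr (@unif_pmf R m n) (fun x => F x == a) =
    \sum_x unif_pmf R x * (F x == a)%:R.
  by split=> h a; [rewrite -E|rewrite E].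
rewrite /Pr big_mkcond; apply: eq_bigr => x _.
by case: eqP => _; rewrite ?mulr1 ?mulr0.
Qed.

Lemma agreement_le (R : realType) (rho : R) (t m k n : nat)
    (F : 'I_k -> word m n -> 'I_m) :
  0 <= rho -> rho < 1 -> (0 < t)%N -> admissible_exponent rho t ->
  (1 < m)%N -> (0 < k)%N -> (forall i, balanced R (F i)) ->
  agreement rho F <= 4 * m%:R * k%:R `^ (- t%:R^-1).
Proof.
move=> rho0 rho1 t0 adm m1 k0 Fbal.
have m0 : (0 < m)%N by apply: ltnW.
pose w i a : word m n -> R := noise_op rho (fun y => (F i y == a)%:R).
have w0 i a x : 0 <= w i a x by apply: noise_op_ge0.
rewrite agreementE //.
apply: (@le_trans _ _ (\sum_x unif_pmf R x *
    \sum_a k%:R^-1 * \sum_i w i a x ^+ k)).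
  apply: ler_sum => x _; rewrite ler_wpM2l ?unif_pmf_ge0 //.
  by apply: ler_sum => a _; apply: prod_le_mean_exprn => // i; apply: w0.
under eq_bigr do rewrite mulr_sumr.
rewrite exchange_big /=.
pose B : R := 4 * k%:R `^ (- t%:R^-1).
have -> : 4 * m%:R * k%:R `^ (- t%:R^-1) = \sum_(a < m) B.
  by rewrite sumr_const card_ord -[B *+ m]mulr_natr /B; ring.
apply: ler_sum => a _.
rewrite (eq_bigr (fun x => k%:R^-1 *
   \sum_i unif_pmf R x * w i a x ^+ k)); last first.
  by move=> x _; rewrite -mulr_sumr [RHS]mulrCA.
rewrite -mulr_sumr exchange_big /= mulrC ler_pdivrMr ?ltr0n //.
have -> : B * k%:R = \sum_(i < k) B by rewrite sumr_const card_ord mulr_natr.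
apply: ler_sum => i _; apply: noise_op_moment_powR => //.
have /balancedE -> := Fbal i.
by rewrite lef_pV2 ?posrE ?ltr0n // ler_nat.
Qed.

(** * A Chernoff bound on product spaces *)

Lemma expR_le_quadratic (R : realType) (y : R) :
  y <= 2^-1 -> expR y <= 1 + y + 2 * y ^+ 2.
Proof.
move=> yhalf.
have hN : 1 - y <= expR (- y) by apply: expR_ge1Dx.
have y1 : 0 < 1 - y by lra.
rewrite -[y in expR y]opprK expRN.
apply: (@le_trans _ _ (1 - y)^-1); first by rewrite lef_pV2 ?posrE ?expR_gt0.
rewrite -div1r ler_pdivrMr // -subr_ge0.
have -> : (1 + y + 2 * y ^+ 2) * (1 - y) - 1 = y ^+ 2 * (1 - 2 * y) by ring.
by rewrite mulr_ge0 ?sqr_ge0 //; lra.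
Qed.

Definition chernoff_rate (R : realType) (eta : R) : R := 1 - eta ^+ 2 / 8.

(** Exponential moment method with parameter [eta / 4], which minimizes the
    bound [1 - lam eta + 2 lam ^ 2] on the moment of one letter. *)
Lemma chernoff (R : realType) (T : finType) (n : nat) (p : 'I_n -> T -> R)
    (d : T -> R) (eta : R) :
  (forall j a, 0 <= p j a) -> (forall j, \sum_a p j a = 1) ->
  (forall a, `|d a| <= 1) -> 0 < eta -> eta <= 1 ->
  (forall j, \sum_a p j a * d a <= - eta) ->
  \sum_(x : {ffun 'I_n -> T}) (\prod_j p j (x j)) *
    (0 <= \sum_j d (x j))%R%:R <= chernoff_rate eta ^+ n.
Proof.
move=> p0 p1 d1 eta0 eta1 drift.
pose lam := eta / 4.
have lam0 : 0 <= lam by rewrite divr_ge0 // ltW.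
apply: (@le_trans _ _ (\sum_(x : {ffun 'I_n -> T})
    \prod_j (p j (x j) * expR (lam * d (x j))))).
  apply: ler_sum => x _; rewrite big_split /= ler_wpM2l ?prodr_ge0 //.
  rewrite -expR_sum -mulr_sumr.
  case: (lerP 0 (\sum_j d (x j))) => [s0|_]; last by rewrite expR_ge0.
  by rewrite -[leLHS]expR0 ler_expR mulr_ge0.
rewrite (sum_prod_ffun (fun j a => p j a * expR (lam * d a))).
rewrite -[X in _ ^+ X]card_ord -prodr_const; apply: ler_prod => j _.
apply/andP; split.
  by apply: sumr_ge0 => a _; rewrite mulr_ge0 ?expR_ge0.
apply: (@le_trans _ _ (\sum_a (p j a + lam * (p j a * d a) +
    2 * lam ^+ 2 * p j a))).
  apply: ler_sum => a _.
  have /ler_normlP[dlo dhi] := d1 a.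
  have quad : lam * d a <= 2^-1.
    have := ler_wpM2l lam0 dhi; rewrite mulr1 => h; apply: le_trans h _.
    by rewrite /lam; lra.
  apply: (le_trans (ler_wpM2l (p0 j a) (expR_le_quadratic quad))).
  have dsq : d a ^+ 2 <= 1 by rewrite -real_normK ?num_real // expr_le1.
  have -> : p j a + lam * (p j a * d a) + 2 * lam ^+ 2 * p j a =
    p j a * (1 + lam * d a + 2 * lam ^+ 2) by ring.
  rewrite ler_wpM2l // lerD2l ler_wpM2l // exprMn ler_piMr ?sqr_ge0 //.
rewrite !big_split /= -!mulr_sumr p1 mulr1.
have := ler_wpM2l lam0 (drift j).
rewrite /chernoff_rate /lam => h; rewrite -subr_ge0.
set s := \sum_a _ in h *.
have -> : 1 - eta ^+ 2 / 8 - (1 + eta / 4 * s + 2 * (eta / 4) ^+ 2) =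
  eta / 4 * - eta - eta / 4 * s by field.
by rewrite subr_ge0.
Qed.

(** * Completing small sets to balanced functions *)

(** List [T] once starting with [A] and once starting with [B], and match the
    two lists by position. *)
Lemma injection_into (T : finType) (A B : {pred T}) :
  (#|A| <= #|B|)%N ->
  exists f : T -> T, injective f /\ {in A, forall x, f x \in B}.
Proof.
move=> cAB; pose e (C : {pred T}) := enum C ++ enum [predC C].
have e_mem C x : x \in e C by rewrite mem_cat !mem_enum inE; apply: orbN.
have e_uniq C : uniq (e C).
  rewrite cat_uniq !enum_uniq andbT; apply/hasPn => x.
  by rewrite !mem_enum inE.
have e_size C : size (e C) = #|T| by rewrite size_cat -!cardE cardC.
pose f x := nth x (e B) (index x (e A)).
have lt x : (index x (e A) < size (e B))%N.
  by rewrite e_size -(e_size A) index_mem.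
exists f; split=> [x y|x xA].
  rewrite /f (set_nth_default y) // => /eqP; rewrite nth_uniq // => /eqP h.
  by rewrite -(nth_index y (e_mem A x)) h nth_index.
have xi : (index x (e A) < #|B|)%N.
  apply: leq_trans cAB; rewrite index_cat mem_enum xA.
  by rewrite cardE index_mem mem_enum.
by rewrite /f nth_cat -cardE xi -mem_enum mem_nth // -cardE.
Qed.

Lemma first_letter_balanced (R : realType) (m n : nat) :
  balanced R (fun x : word m n.+1 => x ord0).
Proof.
apply/balancedE => a; rewrite sum_ffunS (bigD1 a) //= [X in _ + X]big1 ?addr0.
  rewrite (eq_bigr (fun y : word m n => m%:R^-1 * unif_pmf R y)).
    rewrite -mulr_sumr unif_pmf_sum1 ?mulr1 //.
    exact: leq_ltn_trans (ltn_ord a).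
  by move=> y _; rewrite ffun_cons0 eqxx mulr1 /unif_pmf big_ord_recl.
move=> b /negPf ba; rewrite big1 // => y _.
by rewrite ffun_cons0 /= ba mulr0.
Qed.

(** Carry [A] by a bijection of the words into the set of words starting with
    [a0]; then answer the first letter of the image. *)
Lemma exists_balanced_extension (R : realType) (m n : nat)
    (A : pred (word m n.+1)) (a0 : 'I_m) :
  \sum_x unif_pmf R x * (A x)%:R <= m%:R^-1 ->
  exists F : word m n.+1 -> 'I_m, balanced R F /\ forall x, A x -> F x = a0.
Proof.
move=> Asmall.
pose B : pred (word m n.+1) := fun x => x ord0 == a0.
pose c : R := \prod_(j < n.+1) m%:R^-1.
have c0 : 0 < c.
  by apply: prodr_gt0 => j _; rewrite invr_gt0 lt_def ler0n (ord_natr_neq0 _ a0).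
have measE (C : pred (word m n.+1)) :
    \sum_x unif_pmf R x * (C x)%:R = c * #|C|%:R.
  rewrite -mulr_sumr -sum1_card natr_sum; congr (_ * _).
  rewrite [RHS]big_mkcond; apply: eq_bigr => x _.
  by rewrite unfold_in; case: (C x).
have /balancedE/(_ a0) := @first_letter_balanced R m n.
move: Asmall => /[swap] <-; rewrite !measE ler_pM2l // ler_nat => cAB.
have [f [f_inj fAB]] := @injection_into _ A B cAB.
exists (fun x => f x ord0); split; last by move=> x /fAB /eqP.
apply/balancedE => a.
have /balancedE/(_ a) <- := @first_letter_balanced R m n.
by rewrite [RHS](reindex_inj f_inj).
Qed.

(** * Lower bound: threshold sets *)

Definition half_letter (m : nat) (a : 'I_m) : bool := (a < m./2)%N.

Definition half_density (R : realType) (m : nat) : R := m./2%:R * m%:R^-1.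

Definition excess (R : realType) (rho : R) (m : nat) (a : 'I_m) : R :=
  (half_letter a)%:R - (half_density R m + rho / 4).

Definition threshold_set (R : realType) (rho : R) (m n : nat) :
  pred (word m n) := fun x => 0 <= \sum_j excess rho (x j).

Lemma sum_half_letter (R : realType) (m : nat) :
  \sum_(a < m) m%:R^-1 * (half_letter a)%:R = half_density R m.
Proof.
rewrite -mulr_sumr mulrC; congr (_ * _).
rewrite -natr_sum; congr (_%:R).
have h : (m./2 <= m)%N by lia.
transitivity (\sum_(a < m./2) 1)%N; last by rewrite sum1_card card_ord.
rewrite (big_ord_widen _ (fun=> 1%N) h) [RHS]big_mkcond /=.
by apply: eq_bigr => a _; rewrite /half_letter; case: ifP.
Qed.

Lemma half_density_bounds (R : realType) (m : nat) :
  (1 < m)%N -> 3^-1 <= half_density R m /\ half_density R m <= 2^-1.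
Proof.
move=> m1; have m0 : 0 < m%:R :> R by rewrite ltr0n ltnW.
have lo : (m <= 3 * m./2)%N.
  by have := odd_double_half m; case: (odd m) => /=; lia.
have hi : (m./2 * 2 <= m)%N by have := odd_double_half m; lia.
rewrite /half_density ler_pdivlMr // ler_pdivrMr //; split.
  by rewrite mulrC ler_pdivrMr ?ltr0n // mulrC -natrM ler_nat.
by rewrite mulrC ler_pdivlMr ?ltr0n // -natrM ler_nat.
Qed.

Lemma excess_le1 (R : realType) (rho : R) (m : nat) (a : 'I_m) :
  0 < rho -> rho < 1 -> (1 < m)%N -> `|excess rho a| <= 1.
Proof.
move=> rho0 rho1 /(half_density_bounds R)[lo hi].
by rewrite /excess ler_norml; case: (half_letter a) => /=; lra.
Qed.

(** A uniform letter has mean excess [- rho / 4]. *)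
Lemma threshold_set_small (R : realType) (rho : R) (m n : nat) :
  0 < rho -> rho < 1 -> (1 < m)%N ->
  \sum_(x : word m n) unif_pmf R x * (threshold_set rho x)%:R <=
  chernoff_rate (rho / 4) ^+ n.
Proof.
move=> rho0 rho1 m1.
have mn0 : m%:R != 0 :> R by rewrite pnatr_eq0 -lt0n ltnW.
have unif1 : \sum_(a < m) m%:R^-1 = 1 :> R.
  by rewrite sumr_const card_ord -[_^-1 *+ _]mulr_natr mulVf.
rewrite /threshold_set /unif_pmf.
apply: (@chernoff R 'I_m n (fun _ _ => m%:R^-1) (@excess R rho m) (rho / 4)).
- by move=> _ _; rewrite invr_ge0.
- by [].
- by move=> a; apply: excess_le1.
- by lra.
- by lra.
move=> _; rewrite /excess.
rewrite (eq_bigr (fun a : 'I_m => m%:R^-1 * (half_letter a)%:R -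
  (half_density R m + rho / 4) * m%:R^-1)); last by move=> a _; ring.
by rewrite sumrB sum_half_letter -mulr_sumr unif1; lra.
Qed.

(** A copy of a good letter is good with probability [rho + (1 - rho) h], [h]
    being the density of the good letters. As [h <= 1 / 2], this is at least
    [h + rho / 2], so that the mean excess is at least [rho / 4]. *)
Lemma noise_op_threshold_set (R : realType) (rho : R) (m n : nat)
    (x : word m n) :
  0 < rho -> rho < 1 -> (1 < m)%N -> (forall j, half_letter (x j)) ->
  1 - chernoff_rate (rho / 4) ^+ n <=
  noise_op rho (fun y => (threshold_set rho y)%:R) x.
Proof.
move=> rho0 rho1 m1 xhalf; rewrite lerBlDr -lerBlDl -noise_opC.
have mn0 : m%:R != 0 :> R by rewrite pnatr_eq0 -lt0n ltnW.
have [_ hi] := half_density_bounds R m1.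
apply: (@le_trans _ _ (\sum_y word_kernel rho x y *
    (0 <= \sum_j - excess rho (y j))%R%:R)).
  apply: ler_sum => y _; apply: ler_wpM2l.
    by apply: word_kernel_ge0; rewrite // ltW.
  rewrite /threshold_set -ltNge sumrN oppr_ge0 ler_nat.
  by case: (ltP _ 0) => // /ltW ->.
apply: (@chernoff R 'I_m n (fun j => letter_kernel rho (x j))
  (fun a => - excess rho a) (rho / 4)).
- by move=> j a; apply: letter_kernel_ge0; rewrite // ltW.
- by move=> j; apply: letter_kernel_sum1.
- by move=> a; rewrite normrN; apply: excess_le1.
- by lra.
- by lra.
- move=> j; rewrite sum_letter_kernel.
  have -> : \sum_(a < m) m%:R^-1 * - excess rho a = rho / 4.
    rewrite (eq_bigr (fun a : 'I_m => (half_density R m + rho / 4) * m%:R^-1 -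
      m%:R^-1 * (half_letter a)%:R)); last by move=> a _; rewrite /excess; ring.
    rewrite sumrB sum_half_letter -mulr_sumr sumr_const card_ord.
    rewrite -[_^-1 *+ _]mulr_natr mulVf //.
    by rewrite mulr1 addrAC subrr add0r.
  rewrite /excess xhalf mulr1n -subr_ge0; set h := half_density R m in hi *.
  have -> : - (rho / 4) - (rho * - (1 - (h + rho / 4)) +
    (1 - rho) * (rho / 4)) = rho * (2^-1 - h) by field.
  by rewrite mulr_ge0 ?subr_ge0 // ltW.
Qed.

Lemma half_words_measure (R : realType) (m n : nat) : (1 < m)%N ->
  3^-1 ^+ n <= \sum_(x : word m n) unif_pmf R x *
    [forall j, half_letter (x j)]%:R.
Proof.
move=> m1; have [lo _] := half_density_bounds R m1.
rewrite (eq_bigr (fun x : word m n =>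
    \prod_j (m%:R^-1 * (half_letter (x j))%:R))); last first.
  move=> x _; rewrite big_split /=; congr (_ * _).
  case: forallP => [h|h]; first by rewrite big1 // => j _; rewrite h.
  have /existsP[j /negPf hj] : [exists j, ~~ half_letter (x j)].
    by apply: contraT => /existsPn h'; case: h => j; have := h' j; rewrite negbK.
  by rewrite (bigD1 j) //= hj mul0r.
rewrite (sum_prod_ffun (fun _ a => m%:R^-1 * (half_letter a)%:R)).
rewrite prodr_const card_ord sum_half_letter lerXn2r // nnegrE.
  by rewrite invr_ge0.
exact: le_trans lo.
Qed.

(** The bound [r ^ (n + 1) <= 1 / (k m)] serves twice: the threshold set has
    measure at most [1 / m] and can be completed to a balanced function, and
    each player misses it with probability at most [1 / (2 k)] if all the
    letters of [x] are good, so that nobody does with probability at least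
    1/2. *)
Lemma exists_agreement_ge (R : realType) (rho : R) (m k n : nat) :
  0 < rho -> rho < 1 -> (1 < m)%N -> (1 < k)%N ->
  chernoff_rate (rho / 4) ^+ n.+1 <= (k * m)%:R^-1 ->
  exists F : word m n.+1 -> 'I_m, balanced R F /\
    3^-1 ^+ n.+1 / 2 <= agreement rho (fun _ : 'I_k => F).
Proof.
move=> rho0 rho1 m1 k1; set r := chernoff_rate _ => rsmall.
have m0 : (0 < m)%N by apply: ltnW.
have k0 : (0 < k)%N by apply: ltnW.
have rm : r ^+ n.+1 <= m%:R^-1.
  apply: (le_trans rsmall); rewrite lef_pV2 ?posrE ?ltr0n ?muln_gt0 ?k0 //.
  by rewrite ler_nat leq_pmull.
have rk : r ^+ n.+1 * k%:R <= 2^-1.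
  rewrite -ler_pdivlMr ?ltr0n // -invfM -natrM; apply: (le_trans rsmall).
  rewrite lef_pV2 ?posrE ?ltr0n ?muln_gt0 ?k0 //.
  by rewrite ler_nat mulnC leq_mul2l m1 orbT.
have r0 : 0 <= r ^+ n.+1.
  rewrite exprn_ge0 // /r /chernoff_rate subr_ge0 ler_pdivrMr // mul1r.
  by rewrite (@le_trans _ _ 1) // ?expr_le1 ?ler1n //; lra.
pose a0 : 'I_m := Ordinal m0.
have [F [Fbal FA]] := exists_balanced_extension a0
  (le_trans (threshold_set_small n.+1 rho0 rho1 m1) rm).
exists F; split=> //; rewrite agreementE //.
have noise0 a y : 0 <= noise_op rho (fun y => (F y == a)%:R) y.
  by apply: noise_op_ge0; rewrite // ltW.
apply: (@le_trans _ _ (\sum_(x : word m n.+1) unif_pmf R x *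
    [forall j, half_letter (x j)]%:R * 2^-1)).
  by rewrite -mulr_suml ler_wpM2r ?invr_ge0 // half_words_measure.
apply: ler_sum => x _; rewrite -mulrA ler_wpM2l ?unif_pmf_ge0 //.
rewrite (bigD1 a0) //= -[leLHS]addr0; apply: lerD; last first.
  by apply: sumr_ge0 => a _; apply: prodr_ge0 => i _; apply: noise0.
case: forallP => [xhalf|_]; last by rewrite mul0r prodr_ge0.
rewrite mul1r prodr_const card_ord.
have noiseA : 1 - r ^+ n.+1 <= noise_op rho (fun y => (F y == a0)%:R) x.
  apply: (le_trans (noise_op_threshold_set rho0 rho1 m1 xhalf)).
  apply: ler_sum => y _; apply: ler_wpM2l.
    by apply: word_kernel_ge0; rewrite // ltW.
  rewrite ler_nat.
  by case: (boolP (threshold_set rho y)) => // /FA ->; rewrite eqxx.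
have r1 : r ^+ n.+1 <= 1.
  by apply: (le_trans rm); rewrite invf_le1 ?ltr0n // ler1n.
apply: (@le_trans _ _ ((1 - r ^+ n.+1) ^+ k)); last first.
  by rewrite lerXn2r // nnegrE ?subr_ge0.
(* Bernoulli: missing probabilities at most [1 / (2 k)] add up to 1/2. *)
apply: le_trans (bernoulli_expr k _); last by rewrite subr_ge0.
by rewrite addrAC subrr add0r mulrN mulrC; lra.
Qed.

(** * Monotonicity in the length of the words *)

Lemma word_kernel_cons (R : realType) (rho : R) (m n : nat)
    (p q : 'I_m * word m n) :
  word_kernel rho (ffun_cons p : word m n.+1) (ffun_cons q) =
  letter_kernel rho p.1 q.1 * word_kernel rho p.2 q.2.
Proof. exact: (prod_ffun_cons (@letter_kernel R rho m)). Qed.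

Lemma sum_unif_tail (R : realType) (m n : nat) (f : word m n -> R) :
  (0 < m)%N ->
  \sum_(x : word m n.+1) unif_pmf R x * f (ffun_tail x) =
  \sum_x unif_pmf R x * f x.
Proof.
move=> m0; rewrite sum_ffunS exchange_big /=; apply: eq_bigr => x _.
rewrite (eq_bigr (fun=> m%:R^-1 * (unif_pmf R x * f x))); last first.
  by move=> a _; rewrite ffun_consK /unif_pmf big_ord_recl mulrA.
rewrite sumr_const card_ord -[_ *+ m]mulr_natl mulrA mulfV ?mul1r //.
by rewrite pnatr_eq0 -lt0n.
Qed.

Lemma noise_op_tail (R : realType) (rho : R) (m n : nat) (f : word m n -> R)
    (x : word m n.+1) :
  noise_op rho (fun y : word m n.+1 => f (ffun_tail y)) x =
  noise_op rho f (ffun_tail x).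
Proof.
rewrite /noise_op sum_ffunS exchange_big /=; apply: eq_bigr => y _.
have xE : x = ffun_cons (x ord0, ffun_tail x).
  apply/ffunP => j; have [i ->|->] := unliftP ord0 j.
    by rewrite ffun_consS ffunE.
  by rewrite ffun_cons0.
rewrite {1}xE; under eq_bigr do rewrite ffun_consK word_kernel_cons /= -mulrA.
by rewrite -mulr_suml letter_kernel_sum1 mul1r.
Qed.

Lemma agreement_tail (R : realType) (rho : R) (m k n : nat)
    (F : 'I_k -> word m n -> 'I_m) : (0 < m)%N -> (0 < k)%N ->
  agreement rho (fun i (x : word m n.+1) => F i (ffun_tail x)) =
  agreement rho F.
Proof.
move=> m0 k0; rewrite !agreementE // -[RHS]sum_unif_tail //.
apply: eq_bigr => x _; congr (_ * _); apply: eq_bigr => a _.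
apply: eq_bigr => i _.
by rewrite -(noise_op_tail rho (fun y => (F i y == a)%:R)).
Qed.

Lemma balanced_tail (R : realType) (m n : nat) (F : word m n -> 'I_m) :
  (0 < m)%N -> balanced R F ->
  balanced R (fun x : word m n.+1 => F (ffun_tail x)).
Proof.
move=> m0 /balancedE Fbal; apply/balancedE => a.
by rewrite (sum_unif_tail (fun y => (F y == a)%:R)).
Qed.

Lemma agreement_ge0 (R : realType) (rho : R) (m k n : nat)
    (F : 'I_k -> word m n -> 'I_m) :
  0 <= rho -> rho < 1 -> (0 < k)%N -> 0 <= agreement rho F.
Proof.
move=> rho0 rho1 k0; rewrite agreementE //.
apply: sumr_ge0 => x _; rewrite mulr_ge0 ?unif_pmf_ge0 //.
apply: sumr_ge0 => a _; apply: prodr_ge0 => i _.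
exact: noise_op_ge0.
Qed.

Lemma max_agreement_le (R : realType) (rho : R) (t m k n : nat) :
  0 <= rho -> rho < 1 -> (0 < t)%N -> admissible_exponent rho t ->
  (1 < m)%N -> (0 < k)%N ->
  max_agreement rho m k n <= 4 * m%:R * k%:R `^ (- t%:R^-1).
Proof.
move=> rho0 rho1 t0 adm m1 k0; rewrite /max_agreement.
set S := [set agreement rho F | F in _].
have [->|S0] := eqVneq S set0; first by rewrite sup0 !mulr_ge0 ?powR_ge0.
apply: ge_sup; first by apply/set0P.
by move=> _ [F Fbal <-]; apply: agreement_le.
Qed.

Lemma agreement_le_max (R : realType) (rho : R) (t m k n : nat)
    (F : 'I_k -> word m n -> 'I_m) :
  0 <= rho -> rho < 1 -> (0 < t)%N -> admissible_exponent rho t ->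
  (1 < m)%N -> (0 < k)%N -> (forall i, balanced R (F i)) ->
  agreement rho F <= max_agreement rho m k n.
Proof.
move=> rho0 rho1 t0 adm m1 k0 Fbal; apply: ub_le_sup; last by exists F.
exists (4 * m%:R * k%:R `^ (- t%:R^-1)) => _ [G Gbal <-].
exact: agreement_le.
Qed.

(** The case distinction is about the words of length 0: they carry no
    balanced function, and the supremum is that of the empty set. *)
Lemma max_agreement_nondecreasing (R : realType) (rho : R) (t m k : nat) :
  0 <= rho -> rho < 1 -> (0 < t)%N -> admissible_exponent rho t ->
  (1 < m)%N -> (0 < k)%N -> nondecreasing_seq (max_agreement rho m k).
Proof.
move=> rho0 rho1 t0 adm m1 k0; apply/nondecreasing_seqP => n.
have m0 : (0 < m)%N by apply: ltnW.
rewrite {1}/max_agreement; set S := [set agreement rho F | F in _].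
have [->|S0] := eqVneq S set0.
  rewrite sup0; have [E|/set0P[_ [F Fbal _]]] := eqVneq
    [set agreement rho F | F in [set F : 'I_k -> word m n.+1 -> 'I_m |
                                  forall i, balanced R (F i)]] set0.
    by rewrite /max_agreement E sup0.
  apply: le_trans (agreement_le_max rho0 rho1 t0 adm m1 k0 Fbal).
  exact: agreement_ge0.
apply: ge_sup; first by apply/set0P.
move=> _ [F Fbal <-]; rewrite -(agreement_tail rho F m0 k0).
apply: (agreement_le_max rho0 rho1 t0 adm m1 k0) => i.
exact: balanced_tail.
Qed.

(** * Choice of the exponents *)

(** Any [t >= 1 / (1 - rho) ^ 2] works. *)
Lemma exists_admissible_exponent (R : realType) (rho : R) :
  0 < rho -> rho < 1 -> exists2 t, (0 < t)%N & admissible_exponent rho t.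
Proof.
move=> rho0 rho1; pose q := 1 - rho.
have q0 : 0 < q ^+ 2 by rewrite exprn_gt0 // subr_gt0.
exists (Num.truncn (q ^+ 2)^-1).+1 => //.
rewrite /admissible_exponent -/q; set t := (Num.truncn _).+1.
have tq : 1 <= q ^+ 2 * t%:R.
  by rewrite mulrC -ler_pdivrMr // div1r ltW // truncnS_gt.
have t1 : 1 <= t%:R :> R by rewrite ler1n.
have rho21 : rho ^+ 2 <= 1 by rewrite expr_le1 // ltW.
apply: (@le_trans _ _ t.+1%:R).
  by rewrite -[leRHS]mul1r ler_wpM2r.
apply: (@le_trans _ _ (2 * t%:R)); first by rewrite -natr1; lra.
rewrite expr2 [leRHS](_ : _ = (2 * t%:R) * (q ^+ 2 * t%:R)); last by ring.
by rewrite ler_peMr // mulr_ge0.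
Qed.

(** If [r ^ y = 1 / N], then [b ^ (- y)] is a power of [N]; rounding [y] to
    the next integer costs at most a factor [b]. *)
Lemma exists_power_window (R : realType) (r b N : R) :
  0 < r -> r < 1 -> 1 < b -> 1 <= N ->
  exists n : nat, r ^+ n.+1 <= N^-1 /\
    b^-1 * N `^ (- (ln b / - ln r)) <= b^-1 ^+ n.+1.
Proof.
move=> r0 r1 b1 N1.
have b0 : 0 < b by apply: lt_trans b1.
have N0 : 0 < N by apply: lt_le_trans N1.
have L0 : 0 < - ln r by rewrite oppr_gt0 ln_lt0 // r0.
have lnb0 : 0 < ln b by rewrite ln_gt0.
have lnN0 : 0 <= ln N by rewrite ln_ge0.
pose y := ln N / - ln r.
have y0 : 0 <= y by rewrite divr_ge0 // ltW.
have /andP[lo hi] := truncn_itv y0.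
exists (Num.truncn y); set n := Num.truncn y in lo hi *; split.
  rewrite -[r]lnK ?posrE // -expRM_natl -[N]lnK ?posrE // -expRN ler_expR.
  move: hi; rewrite ltr_pdivrMr // mulrN => h; rewrite lerNr; exact: ltW.
have bE : b^-1 = expR (- ln b) by rewrite expRN lnK ?posrE.
rewrite bE -expRM_natl -[N in N `^ _]lnK ?posrE // -expRM -expRD ler_expR.
rewrite -natr1 mulrDl mul1r addrC lerD2r mulrN mulrN lerN2.
rewrite [leRHS](_ : _ = y * ln b); first by rewrite ler_wpM2r // ltW.
by rewrite /y; field; rewrite lt_eqF // -oppr_gt0.
Qed.

Lemma chernoff_rate_itv (R : realType) (eta : R) :
  0 < eta -> eta <= 1 -> 0 < chernoff_rate eta < 1.
Proof.
move=> eta0 eta1; have : eta ^+ 2 <= 1 by rewrite expr_le1 // ltW.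
have : 0 < eta ^+ 2 by rewrite exprn_gt0.
by rewrite /chernoff_rate => *; apply/andP; split; lra.
Qed.

(** * Polynomial decay of the agreement probability *)

Theorem theorem1p16 (R : realType) (rho : R) (rho_gt0 : 0 < rho)
    (rho_lt1 : rho < 1) :
  exists gamma1 gamma2 : R, [/\ 0 < gamma1, 0 < gamma2 &
    forall m : nat, (2 <= m)%N ->
    exists c1 c2 : R, [/\ 0 < c1, 0 < c2 &
      forall k : nat, (2 <= k)%N ->
      [/\ cvgn (max_agreement rho m k),
          c2 * k%:R `^ (- gamma2) <= limn (max_agreement rho m k)
        & limn (max_agreement rho m k) <= c1 * k%:R `^ (- gamma1)]]].
Proof.
have rho0 := ltW rho_gt0.
have [t t0 adm] := exists_admissible_exponent rho_gt0 rho_lt1.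
have /andP[r0 r1] : 0 < chernoff_rate (rho / 4) < 1.
  by apply: chernoff_rate_itv; lra.
set r := chernoff_rate (rho / 4) in r0 r1.
pose gamma2 : R := ln 3 / - ln r.
have three1 : 1 < 3 :> R by rewrite ltr1n.
exists t%:R^-1, gamma2; split.
- by rewrite invr_gt0 ltr0n.
- by rewrite divr_gt0 ?ln_gt0 // oppr_gt0 ln_lt0 // r0.
move=> m m1; have m0 : (0 < m)%N by apply: ltnW.
have mR : 0 < m%:R :> R by rewrite ltr0n.
exists (4 * m%:R), (3^-1 * m%:R `^ (- gamma2) / 2); split.
- by rewrite mulr_gt0.
- by rewrite divr_gt0 // mulr_gt0 ?invr_gt0 // powR_gt0.
move=> k k1; have k0 : (0 < k)%N by apply: ltnW.
have incr := max_agreement_nondecreasing rho0 rho_lt1 t0 adm m1 k0.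
have ub n := max_agreement_le n rho0 rho_lt1 t0 adm m1 k0.
have cvg_max : cvgn (max_agreement rho m k).
  by apply: nondecreasing_is_cvgn => //; eexists=> _ [n _ <-]; apply: ub.
split=> //; last by apply: limr_le => //; apply: nearW.
have [|n [rn bn]] := exists_power_window r0 r1 three1 (N := (k * m)%:R).
  by rewrite ler1n muln_gt0 k0.
have [F [Fbal Fagree]] := exists_agreement_ge rho_gt0 rho_lt1 m1 k1 rn.
apply: le_trans (nondecreasing_cvgn_le incr cvg_max n.+1).
apply: le_trans (agreement_le_max rho0 rho_lt1 t0 adm m1 k0 (fun=> Fbal)).
apply: le_trans Fagree; rewrite mulrAC ler_wpM2r ?invr_ge0 //.
by apply: le_trans bn; rewrite natrM powRM ?ler0n // -mulrA [X in _ * X]mulrC.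
Qed.
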